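(* For any avoidable set $U\subseteq\mathbb{N}$ (with respect to $(\mathbb{N},+)$), $ELD(U)\le\frac{\sqrt5-1}{2}$.
   Context: For a set $S$ with a binary operation, a subset $U\subseteq S$ is avoidable if there is a partition $\{A,B\}$ of $S$ such that no element of $U$ is the product (here: sum) of two distinct elements of $A$ or of two distinct elements of $B$. Here $S=\mathbb{N}$ with ordinary addition. For $U\subseteq\mathbb{N}$, let $U_2(n)$ be the number of even elements of $U$ less than $n$; the even logarithmic density is $ELD(U)=\limsup_{n\to\infty}\exp\!\big(-\frac{\log(n/2)}{U_2(n)}\big)$. *)

(* Defs.v *)
From HB Require Import structures.
From mathcomp Require Import all_boot all_order all_algebra.
From mathcomp Require Import all_classical all_reals all_analysis.
Set Implicit Arguments.
Unset Strict Implicit.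
Unset Printing Implicit Defensive.
Import Order.TTheory GRing.Theory Num.Theory.
Import numFieldNormedType.Exports.
Local Open Scope classical_set_scope.
Local Open Scope ring_scope.

(* S is the carrier, a subset of T on which op is meant to be an internal
   operation. The blocks A and B may be empty; as soon as S has two elements
   this makes no difference, since if A = S works then so does any splitting
   of S. *)
Definition avoidable (T : Type) (op : T -> T -> T) (S U : set T) : Prop :=
  U `<=` S /\
  exists A B : set T,
    [/\ A `|` B = S,
        A `&` B = set0,
        forall x y, A x -> A y -> x <> y -> ~ U (op x y) &
        forall x y, B x -> B y -> x <> y -> ~ U (op x y)].

(* The natural numbers start at 1 here. *)
Definition Npos : set nat := [set n | (0 < n)%N].

Definition even_count (U : set nat) (n : nat) : nat :=
  #|[set i : 'I_n | ~~ odd i & nat_of_ord i \in U]|.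

(* The quotient is taken in the extended reals, where 0^-1 = +oo (inve0) and
   expeR -oo = 0: the n-th term is 0 when n > 2 and U has no even element
   below n. *)
Definition ELD (R : realType) (U : set nat) : \bar R :=
  limn_esup (fun n : nat =>
    expeR (- ((ln (n%:R / 2))%:E / ((even_count U n)%:R)%:E)))%E.

(* Main.v *)
Require Import Defs.
From HB Require Import structures.
From mathcomp Require Import all_boot all_order all_algebra.
From mathcomp Require Import all_classical all_reals all_analysis.
From mathcomp Require Import zify ring lra.
Import Order.TTheory GRing.Theory Num.Theory.
Local Open Scope classical_set_scope.
Local Open Scope ring_scope.

(** If [a < b < c < a + b] were even elements of [U], then [(a + b - c)/2],
    [(a + c - b)/2] and [(b + c - a)/2] would be three distinct positive
    integers with pairwise sums [a], [b], [c], and no two-block partition could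
    separate them. So each even element of [U] is at least the sum of any two
    smaller ones, and the [k]-th one is at least [2 phi^(k-1)], where [phi] is
    the golden ratio. Hence [ln (n/2) >= (U_2(n) - 1) ln phi], and
    the limit superior is at most [1/phi]. *)

Lemma avoidable_even_sum (U : set nat) (a b c : nat) :
  avoidable addn Npos U -> U a -> U b -> U c ->
  ~~ odd a -> ~~ odd b -> ~~ odd c -> (a < b < c)%N -> (a + b <= c)%N.
Proof.
move=> [_ [A [B [AB _ hA hB]]]] Ua Ub Uc ea eb ec /andP[ab bc].
rewrite leqNgt; apply/negP => cab.
have [x [y [z [xy xz yz [x0 lxy lyz]]]]] : exists x y z : nat,
    [/\ x + y = a, x + z = b, y + z = c & [/\ 0 < x, x < y & y < z]]%N.
  (* Evenness makes the half exact. Here [x < y] amounts to [b < c], [y < z] to [a < b], and [0 < x]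
     to the assumption [c < a + b]. *)
  exists (a + b - c)./2, (a - (a + b - c)./2)%N, (b - (a + b - c)./2)%N.
  by split=> [|||]; [lia|lia|lia|split; lia].
have col t : (0 < t)%N -> A t \/ B t by move=> t0; have : Npos t by []; rewrite -AB.
have block C : (forall s t, C s -> C t -> s <> t -> ~ U (s + t)%N) ->
    [/\ C x -> ~ C y, C x -> ~ C z & C y -> ~ C z].
  move=> hC; split=> Cs Ct.
  - by apply: (hC x y) => //; [lia | rewrite xy].
  - by apply: (hC x z) => //; [lia | rewrite xz].
  - by apply: (hC y z) => //; [lia | rewrite yz].
have [A1 A2 A3] := block A hA; have [B1 B2 B3] := block B hB.
have y0 : (0 < y)%N by lia.
have z0 : (0 < z)%N by lia.
have := col x x0; have := col y y0; have := col z z0; tauto.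
Qed.

Lemma even_countS (U : set nat) (n : nat) :
  even_count U n.+1 = (even_count U n + (~~ odd n && (n \in U)))%N.
Proof.
by rewrite /even_count -!sum1dep_card big_mkcond big_ord_recr -big_mkcond /=;
  case: ifP.
Qed.

(** The witness is the largest even element of [U] below [n]; a second application, at [u], reaches
    the one before it. *)
Lemma even_count_pred (U : set nat) (n k : nat) : even_count U n = k.+1 ->
  exists u, [/\ (u < n)%N, ~~ odd u, U u & even_count U u = k].
Proof.
elim: n => [|n IH].
  by rewrite /even_count -sum1dep_card big_ord0.
rewrite even_countS; case: (boolP (~~ odd n && (n \in U))) => /= [/andP[on nU]|_].
  by rewrite addn1 => -[<-]; exists n; split=> //; rewrite -in_setE.
by rewrite addn0 => /IH[u [un ou Uu cu]]; exists u; split=> //; exact: ltnW.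
Qed.

(** Strong induction: the two preceding even elements give [phi ^+ k + phi ^+ k.+1 = phi ^+ k.+2].
    The count is strict, so the smallest even element has exponent 0. *)
Lemma even_element_ge (R : realType) (U : set nat) (phi : R) (u : nat) :
  avoidable addn Npos U -> phi <= 2 -> phi ^+ 2 = phi + 1 ->
  U u -> ~~ odd u ->
  2 * phi ^+ even_count U u <= u%:R.
Proof.
move=> hU phi_le2 phi_sqr.
have Upos t : U t -> (0 < t)%N by move=> Ut; exact: hU.1.
elim/ltn_ind: u => u IH Uu ou.
case ck : (even_count U u) => [|k].
  have : (2 <= u)%N by move: (Upos _ Uu) ou; case: u {IH Uu ck} => [|[|]].
  by rewrite -(ler_nat R) expr0 mulr1.
have [v [vu ov Uv cv]] := even_count_pred _ _ _ ck.
have IHv := IH v vu Uv ov.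
case: k ck cv => [|k] ck cv.
  have v0 := Upos _ Uv.
  (* Only one predecessor is available here; [u] is at least the second positive even number, and
     [4 >= 2 * phi]. *)
  have u4 : (4 : R) <= u%:R by rewrite ler_nat; move: ov ou; lia.
  by rewrite expr1; lra.
have [w [wv ow Uw cw]] := even_count_pred _ _ _ cv.
have IHw := IH w (ltn_trans wv vu) Uw ow.
have := avoidable_even_sum U w v u hU Uw Uv Uu ow ov ou.
rewrite wv vu => /(_ isT); rewrite -(ler_nat R) natrD.
apply: le_trans; rewrite cv in IHv; rewrite cw in IHw.
apply: le_trans (lerD IHw IHv).
by rewrite -(addn2 k) exprD phi_sqr exprS; lra.
Qed.

(** The extra factor [phi] arises because the last even element below [n] is counted at [n] but not
    at itself. *)
Lemma even_count_exp_le (R : realType) (U : set nat) (phi : R) (n : nat) :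
  avoidable addn Npos U -> phi <= 2 -> phi ^+ 2 = phi + 1 ->
  1 <= phi -> (2 <= n)%N ->
  phi ^+ even_count U n <= phi * (n%:R / 2).
Proof.
move=> hU phi_le2 phi_sqr phi1 n2.
have phi_gt0 : 0 < phi by lra.
have n2R : (2 : R) <= n%:R by rewrite ler_nat.
case ck : (even_count U n) => [|k].
  by rewrite expr0; nra.
have [u [un ou Uu cu]] := even_count_pred _ _ _ ck.
have := even_element_ge R U phi u hU phi_le2 phi_sqr Uu ou; rewrite cu => hu.
have : (u%:R : R) <= n%:R by rewrite ler_nat ltnW.
by rewrite exprS ler_pM2l //; lra.
Qed.

Lemma even_count_ln_le (R : realType) (U : set nat) (phi : R) (n : nat) :
  avoidable addn Npos U -> phi <= 2 -> phi ^+ 2 = phi + 1 ->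
  1 <= phi -> (2 <= n)%N ->
  ((even_count U n)%:R - 1) * ln phi <= ln (n%:R / 2).
Proof.
move=> hU phi_le2 phi_sqr phi1 n2.
have phi_gt0 : 0 < phi by lra.
have n0 : (0 : R) < n%:R / 2 by rewrite divr_gt0 // ltr0n ltnW.
have phin0 : 0 < phi * (n%:R / 2) by rewrite mulr_gt0.
have := even_count_exp_le R U phi n hU phi_le2 phi_sqr phi1 n2.
rewrite -ler_ln ?posrE ?exprn_gt0 // lnXn // lnM ?posrE //.
by rewrite mulrBl mul1r lerBlDl [_ * ln phi]mulr_natl.
Qed.

Lemma limn_esup_le_near (R : realType) (u : (\bar R)^nat) (x : \bar R) :
  (\forall n \near \oo, (u n <= x)%E) -> (limn_esup u <= x)%E.
Proof.
(* The upper limit is an infimum of suprema over sets of the filter, and the set where the bound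
   holds is one of them. *)
move=> ux; apply: ge_ereal_inf; exists (ereal_sup (u @` [set n | (u n <= x)%E])).
  by exists [set n | (u n <= x)%E].
by apply: ge_ereal_sup => _ [n /= unx <-].
Qed.

Lemma near_ln_half_ge (R : realType) (M : R) :
  \forall n \near \oo, M <= ln (n%:R / 2 : R).
Proof.
near=> n.
rewrite -(expRK M) ler_ln ?posrE ?expR_gt0 ?ler_pdivlMr ?divr_gt0 ?ltr0n //.
  by near: n; exact: nbhs_infty_ger.
by near: n; exact: nbhs_infty_gt.
Unshelve. all: by end_near. Qed.

Theorem theorem3p3 (R : realType) (U : set nat) (hU : avoidable addn Npos U) :
  (ELD R U <= ((Num.sqrt 5 - 1) / 2 : R)%:E)%E.
Proof.
pose s : R := Num.sqrt 5; rewrite -/s.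
have s2 : s ^+ 2 = 5 by rewrite sqr_sqrtr.
have s0 : 0 <= s by exact: sqrtr_ge0.
pose phi := (s + 1) / 2.
have phi_sqr : phi ^+ 2 = phi + 1 by rewrite /phi; lra.
have s_gt2 : 2 < s by nra.
have s_lt3 : s < 3 by nra.
have phi_ge1 : 1 <= phi by rewrite /phi; lra.
have phi_le2 : phi <= 2 by rewrite /phi; lra.
have phi0 : 0 < phi by lra.
have -> : (s - 1) / 2 = phi^-1.
  by apply: (mulfI (lt0r_neq0 phi0)); rewrite mulfV ?lt0r_neq0 // /phi; lra.
apply/lee_addgt0Pr => e e0; rewrite -EFinD.
have c0 : 0 < phi^-1 + e by rewrite addr_gt0 ?invr_gt0.
set c := _ + e in c0 *.
(* [d] is positive because [phi * c = 1 + phi * e]. *)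
pose d := ln phi + ln c.
have d0 : 0 < d.
  rewrite /d -lnM ?posrE // ln_gt0 // /c mulrDr mulfV ?lt0r_neq0 //.
  by rewrite ltrDl mulr_gt0.
have L0 : 0 <= ln phi by exact: ln_ge0.
apply: limn_esup_le_near; near=> n.
have n2 : (2 <= n)%N by near: n; exact: nbhs_infty_ge.
have hn := even_count_ln_le R U phi n hU phi_le2 phi_sqr phi_ge1 n2.
have h1 : 1 <= ln (n%:R / 2 : R) by near: n; exact: near_ln_half_ge.
have hM : ln phi ^+ 2 / d <= ln (n%:R / 2 : R) by near: n; exact: near_ln_half_ge.
rewrite -(lnK c0) -[X in (_ <= X)%E]/(expeR (ln c)%:E) lee_expeR.
case ck : (even_count U n) => [|k].
  (* With count 0 the quotient is [+oo], since [h1] makes the logarithm positive. *)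
  by rewrite inve0 gt0_muley ?lte_fin ?leNye //; lra.
have k0 : (0 : R) < k.+1%:R by rewrite ltr0n.
rewrite inver gt_eqF // -EFinM -EFinN lee_fin -mulNr ler_pdivrMr //.
rewrite ck in hn.
have -> : ln c = d - ln phi by rewrite /d; ring.
(* With [m = k.+1], the goal amounts to [m * ln phi - m * d <= ln (n / 2)]. If [m * d >= ln phi], it
   follows from [hn]; otherwise [m < ln phi / d], so [m * ln phi] is at most the threshold in
   [hM]. *)
have [kd|kd] := leP (ln phi) (k.+1%:R * d); first nra.
rewrite ler_pdivrMr // in hM.
suff : ln phi * k.+1%:R <= ln (n%:R / 2) by nra.
by rewrite -(ler_pM2r d0) (le_trans _ hM) //; nra.
Unshelve. all: by end_near. Qed.
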